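(* Let $X^+_s, X^-_s:\mathbb{Z}\to\mathbb{C}$ ($s\in\mathbb{R}$) be functions such that $s\mapsto X^\pm_s(i)$ is smooth for every $i\in\mathbb{Z}$, and let $X_s$ be the time-dependent vector field on $\mathbb{Z}$ with components $X^\pm_s$. Then the following are equivalent. (1) For all $s$, $X_s$ is real, i.e. $\overline{X^+}=-R_+(X^-)$ (equivalently $\overline{X^-}=-R_-(X^+)$), and $X_s$ satisfies the geodesic velocity equations for the constant metric on $\mathbb{Z}$, \[ \dot X^+=(\partial_+\kappa)X^+-(\partial_+X^+)X^+-(\partial_-X^+)X^-,\qquad \dot X^-=(\partial_-\kappa)X^--(\partial_-X^-)X^--(\partial_+X^-)X^+, \] where $\kappa=-\tfrac12(\partial_-X^++\partial_+X^-)$. (2) There exist a constant $r\in\mathbb{R}_{\ge 0}$ (independent of $i\in\mathbb{Z}$ and of $s$) and real-valued functions $\theta_s:\mathbb{Z}\to\mathbb{R}$, smooth in $s$ at each $i\in\mathbb{Z}$, such that for all $s$ \[ X^+=r e^{\mathrm{i}\theta},\qquad X^-=-R_-(r e^{-\mathrm{i}\theta}),\qquad \dot\theta=r(R_--R_+)(\sin\theta). \] In this case $\kappa=-r\,\partial_-\cos(\theta)$, and the amplitude flow equation $\dot\psi=-(\partial_+\psi)X^+-(\partial_-\psi)X^--\psi\kappa$ for $\psi_s:\mathbb{Z}\to\mathbb{C}$ becomes \[ \dot\psi=-r(\partial_+\psi)e^{\mathrm{i}\theta}+r(\partial_-\psi)R_-(e^{-\mathrm{i}\theta})-\psi\kappa.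 \]
   Context: For a function $f:\mathbb{Z}\to\mathbb{C}$ put $R_\pm(f)(i)=f(i\pm1)$ and $\partial_\pm f=R_\pm(f)-f$. All products of functions on $\mathbb{Z}$ are pointwise, functions such as $e^{\mathrm{i}\theta}$, $\sin\theta$, $\cos\theta$ are taken pointwise, and the bar is pointwise complex conjugation. A dot denotes differentiation with respect to the geodesic time $s\in\mathbb{R}$, pointwise in $i\in\mathbb{Z}$; the subscript $s$ is suppressed in the equations. A time-dependent vector field on the lattice line $\mathbb{Z}$ is given by its two components $X^\pm_s:\mathbb{Z}\to\mathbb{C}$. *)

(* Defs.v *)
From Stdlib Require Import Reals ZArith.
From Coquelicot Require Import Coquelicot.
Open Scope C_scope.

(* Complex-valued curves are treated as curves in a two-dimensional real normed
   space: the parameter s is real, so [is_derive] must be taken over R. *)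
Definition has_deriv (f : R -> C) (s : R) (l : C) : Prop :=
  is_derive (K := R_AbsRing) (V := C_R_NormedModule) f s l.

Definition smooth (f : R -> R) : Prop :=
  forall (n : nat) (s : R), ex_derive_n f n s.

Definition smoothC (f : R -> C) : Prop :=
  smooth (fun s => Re (f s)) /\ smooth (fun s => Im (f s)).

(* The complex exponential, which Coquelicot does not provide. *)
Definition Cexp (z : C) : C :=
  RtoC (exp (Re z)) * (RtoC (cos (Im z)) + Ci * RtoC (sin (Im z))).

Definition shiftp {T : Type} (f : Z -> T) : Z -> T := fun i => f (i + 1)%Z.
Definition shiftm {T : Type} (f : Z -> T) : Z -> T := fun i => f (i - 1)%Z.

Definition partialp (f : Z -> C) : Z -> C := fun i => shiftp f i - f i.
Definition partialm (f : Z -> C) : Z -> C := fun i => shiftm f i - f i.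

(* A vector field on the lattice line is the pair of its components
   Xp = X^+ and Xm = X^-; the time-dependent ones are indexed by s : R. *)
Definition real_field (Xp Xm : Z -> C) : Prop :=
  forall i, Cconj (Xp i) = - shiftp Xm i.

Definition real_field_alt (Xp Xm : Z -> C) : Prop :=
  forall i, Cconj (Xm i) = - shiftm Xp i.

Definition kappa (Xp Xm : Z -> C) : Z -> C :=
  fun i => - RtoC (1 / 2) * (partialm Xp i + partialp Xm i).

Definition geodesic_velocity_eqs (Xp Xm : R -> Z -> C) (s : R) : Prop :=
  (forall i, has_deriv (fun t => Xp t i) s
     (partialp (kappa (Xp s) (Xm s)) i * Xp s i
      - partialp (Xp s) i * Xp s i
      - partialm (Xp s) i * Xm s i)) /\
  (forall i, has_deriv (fun t => Xm t i) s
     (partialm (kappa (Xp s) (Xm s)) i * Xm s i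
      - partialm (Xm s) i * Xm s i
      - partialp (Xm s) i * Xp s i)).

Definition amplitude_flow_eq (Xp Xm psi : R -> Z -> C) (s : R) : Prop :=
  forall i, has_deriv (fun t => psi t i) s
    (- partialp (psi s) i * Xp s i
     - partialm (psi s) i * Xm s i
     - psi s i * kappa (Xp s) (Xm s) i).

Definition polar_solution (Xp Xm : R -> Z -> C) (r : R) (theta : R -> Z -> R)
  : Prop :=
  (0 <= r)%R /\
  (forall i, smooth (fun s => theta s i)) /\
  (forall s i, Xp s i = RtoC r * Cexp (Ci * RtoC (theta s i))) /\
  (forall s i,
     Xm s i = - shiftm (fun j => RtoC r * Cexp (- (Ci * RtoC (theta s j)))) i) /\
  (forall s i,
     is_derive (fun t => theta t i) s
       (r * (shiftm (fun j => sin (theta s j)) i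
             - shiftp (fun j => sin (theta s j)) i))%R).

(* Main.v *)
Require Import Defs.
From Stdlib Require Import Reals ZArith Lra.
From Coquelicot Require Import Coquelicot.
Open Scope C_scope.

(** Reality means that [X^-] is determined by [a = X^+], and the two velocity
    equations then become two equations for [a_i], which differ only in their
    real terms [|a_(i-1)|^2 - |a_i|^2] and [|a_i|^2 - |a_(i+1)|^2].  Hence
    [|a_i|^2] is an arithmetic progression in [i]; being nonnegative on all of
    [Z], it is constant in [i].  What remains is [a_i' = i w_i a_i] with
    [w_i = Im a_(i-1) - Im a_(i+1)] real, so that [|a_i|] is also constant in
    time and [a_i = r exp (i theta_i)] with [theta_i] a primitive of [w_i]. *)

(** * Differentiation of complex curves by real and imaginary parts *)

Lemma is_derive_pair (f g : R -> R) (s : R) (a b : R) :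
  is_derive f s a -> is_derive g s b ->
  has_deriv (fun t => (f t, g t)) s (a, b).
Proof.
  intros Hf Hg; unfold has_deriv.
  apply (filterdiff_ext_lin _ (fun y : R => (scal y a, scal y b) : C)).
  - refine (filterdiff_comp'_2 (K := R_AbsRing) (W := C_R_NormedModule) f g
      (fun u v => (u, v)) s _ _ (fun u v => (u, v)) Hf Hg _).
    (* Pairing is the identity of the product space up to eta for pairs, so it is its own
       differential. *)
    apply (filterdiff_ext_lin _ (fun t => t)).
    + apply (filterdiff_ext (fun t : R * R => t)).
      * now intros [u v].
      * apply filterdiff_id.
    + now intros [u v].
  - intros y; reflexivity.
Qed.

Lemma has_deriv_iff (f : R -> C) (s : R) (l : C) :
  has_deriv f s l <->
  is_derive (fun t => Re (f t)) s (Re l) /\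
  is_derive (fun t => Im (f t)) s (Im l).
Proof.
  split.
  - intros H; split.
    + exact (filterdiff_comp' f (fun z : C => fst z) s _ _ H
        (filterdiff_linear _ is_linear_fst)).
    + exact (filterdiff_comp' f (fun z : C => snd z) s _ _ H
        (filterdiff_linear _ is_linear_snd)).
  - intros [H1 H2]; destruct l as [a b].
    apply (is_derive_ext (V := C_R_NormedModule) (fun t => (Re (f t), Im (f t)))).
    + intros t; now destruct (f t).
    + now apply is_derive_pair.
Qed.

Lemma has_deriv_unique (f : R -> C) (s : R) (k l : C) :
  has_deriv f s k -> has_deriv f s l -> k = l.
Proof.
  intros [H1 H2]%has_deriv_iff [H3 H4]%has_deriv_iff.
  apply injective_projections.
  - transitivity (Derive (fun t => Re (f t)) s);
      [ symmetry | ]; now apply is_derive_unique.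
  - transitivity (Derive (fun t => Im (f t)) s);
      [ symmetry | ]; now apply is_derive_unique.
Qed.

Lemma has_deriv_ext (f g : R -> C) (s : R) (l : C) :
  (forall t, f t = g t) -> has_deriv f s l -> has_deriv g s l.
Proof. exact (is_derive_ext (V := C_R_NormedModule) f g s l). Qed.

(** The map [z -> - Cconj z] is real-linear, which suffices for a real parameter. Reality relates
    [X^+] at [i] and [X^-] at [i + 1] by this map, so it carries derivatives from one component to
    the other. *)
Lemma has_deriv_opp_conj (f : R -> C) (s : R) (l : C) :
  has_deriv f s l -> has_deriv (fun t => - Cconj (f t)) s (- Cconj l).
Proof.
  intros [H1 H2]%has_deriv_iff; apply has_deriv_iff; split; simpl.
  - now apply (is_derive_opp (fun t => Re (f t))).
  - apply (is_derive_opp (fun t => (- Im (f t))%R)).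
    now apply (is_derive_opp (fun t => Im (f t))).
Qed.

(** * Real one-variable facts: constancy, smoothness, progressions *)

Lemma is_derive_0_eq (f : R -> R) :
  (forall s, is_derive f s 0%R) -> forall s t, f s = f t.
Proof.
  intros H s t.
  destruct (Rtotal_order s t) as [L | [-> | L]]; trivial.
  - apply (eq_is_derive f); auto.
  - symmetry; apply (eq_is_derive f); auto.
Qed.

Lemma smooth_primitive (f g : R -> R) :
  (forall s, is_derive f s (g s)) -> smooth g -> smooth f.
Proof.
  intros H Hg n s.
  assert (E : forall k t, Derive_n f (S k) t = Derive_n g k t).
  { induction k as [ | k IH]; intros t.
    - apply is_derive_unique, H.
    - change (Derive (Derive_n f (S k)) t = Derive (Derive_n g k) t).
      now apply Derive_ext. }
  (* Order 0 is trivially true, order 1 is the hypothesis on [f], and order [n + 2] of [f] is order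
     [n + 1] of [g]. *)
  destruct n as [ | [ | n]]; simpl; trivial.
  - exists (g s); apply H.
  - apply (ex_derive_ext (Derive_n g n)); [ now intros t; rewrite <- E | ].
    apply (Hg (S n)).
Qed.

Lemma smooth_minus (f g : R -> R) :
  smooth f -> smooth g -> smooth (fun s => f s - g s)%R.
Proof.
  intros Hf Hg n s; apply ex_derive_n_minus; apply filter_forall; intros; auto.
Qed.

Lemma smooth_continuous (f : R -> R) (s : R) : smooth f -> continuous f s.
Proof. intros H; apply (ex_derive_continuous (V := R_NormedModule)), (H 1%nat). Qed.

(** A nonzero common difference would make the progression negative far out in one of the two
    directions of [Z]. *)
Lemma nonneg_arith_progression_const (n : Z -> R) :
  (forall i, 0 <= n i)%R ->
  (forall i, n (i - 1)%Z - n i = n i - n (i + 1)%Z)%R ->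
  forall i, n i = n 0%Z.
Proof.
  intros Hpos Hn.
  set (d := (n 1%Z - n 0%Z)%R).
  assert (Hstep : forall i, (n (i + 1)%Z - n i = d)%R).
  { intros i; pattern i; apply Z.bi_induction.
    - now intros ? ? ->.
    - reflexivity.
    - intros j; specialize (Hn (j + 1)%Z).
      rewrite Z.add_simpl_r in Hn; unfold Z.succ; split; lra. }
  assert (Hlin : forall i, (n i = n 0%Z + IZR i * d)%R).
  { intros i; pattern i; apply Z.bi_induction.
    - now intros ? ? ->.
    - simpl; ring.
    - intros j; specialize (Hstep j); unfold Z.succ; rewrite plus_IZR.
      split; lra. }
  assert (Hd : d = 0%R).
  { destruct (Rtotal_order d 0) as [L | [E | L]]; trivial; exfalso.
    (* The index [up (n 0 / - d)] exceeds the zero of [n 0 + x * d], so [n] is negative there; for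
       [d > 0] the mirrored index does the same. *)
    - pose proof (proj1 (archimed (n 0%Z / - d))) as A.
      pose proof (Hpos (up (n 0%Z / - d))) as P; rewrite Hlin in P.
      apply (Rmult_lt_compat_r (- d)) in A; [ | lra].
      unfold Rdiv in A; rewrite Rmult_assoc, Rinv_l in A; unfold Rdiv in P; lra.
    - pose proof (proj1 (archimed (n 0%Z / d))) as A.
      pose proof (Hpos (- up (n 0%Z / d))%Z) as P; rewrite Hlin, opp_IZR in P.
      apply (Rmult_lt_compat_r d) in A; [ | lra].
      unfold Rdiv in A; rewrite Rmult_assoc, Rinv_l in A; unfold Rdiv in P; lra. }
  intros i; rewrite Hlin, Hd; ring.
Qed.

(** * Polar coordinates and rotation in the plane *)

Definition angle (p q : R) : R :=
  let r := sqrt (p * p + q * q) in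
  if Rle_dec 0 q then acos (p / r) else (- acos (p / r))%R.

(** Since [acos] covers only the upper half circle, the sign of [q] selects the branch. At the
    origin any angle will do, because [r = 0] multiplies both functions. *)
Lemma angle_spec (p q : R) :
  let r := sqrt (p * p + q * q) in
  p = (r * cos (angle p q))%R /\ q = (r * sin (angle p q))%R.
Proof.
  unfold angle; cbv zeta; set (r := sqrt (p * p + q * q)).
  assert (Hr : (r * r = p * p + q * q)%R) by (apply sqrt_sqrt; nra).
  assert (Hr0 : (0 <= r)%R) by apply sqrt_pos.
  destruct (Req_dec r 0) as [E | E].
  - rewrite E in *; split; nra.
  - assert (Hx : (p = r * (p / r))%R) by now field.
    assert (Hy : (q = r * (q / r))%R) by now field.
    set (x := (p / r)%R) in *; set (y := (q / r)%R) in *.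
    clearbody r x y; subst p q.
    assert (Hxy : (1 - Rsqr x = Rsqr y)%R).
    { unfold Rsqr; apply (Rmult_eq_reg_l (r * r)); nra. }
    assert (B : (-1 <= x <= 1)%R) by (unfold Rsqr in Hxy; nra).
    (* On the unit circle [sin (acos x) = sqrt (1 - x^2) = |y|]; since [r > 0], the test on [r * y]
       then decides the sign of [y]. *)
    assert (Hs : sin (acos x) = Rabs y)
      by (rewrite sin_acos, Hxy by exact B; apply sqrt_Rsqr_abs).
    destruct (Rle_dec 0 (r * y)) as [L | L].
    + assert (0 <= y)%R by nra.
      rewrite cos_acos, Hs, Rabs_pos_eq; auto.
    + assert (y < 0)%R by nra.
      rewrite cos_neg, sin_neg, cos_acos, Hs, Rabs_left; auto.
      now rewrite Ropp_involutive.
Qed.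

(** This integrates [z' = i w z] for [z = p + i q] without an ODE uniqueness theorem. Nothing is
    divided by [r], so [r = 0] is included. *)
Lemma rotation_solution (p q w theta : R -> R) (r : R) :
  (forall s, is_derive p s (- (w s * q s))%R) ->
  (forall s, is_derive q s (w s * p s)%R) ->
  (forall s, is_derive theta s (w s)) ->
  p 0%R = (r * cos (theta 0))%R -> q 0%R = (r * sin (theta 0))%R ->
  forall s, p s = (r * cos (theta s))%R /\ q s = (r * sin (theta s))%R.
Proof.
  intros Hp Hq Ht Hp0 Hq0 s.
  (* [u + i v = (p + i q) exp (- i theta)] is constant *)
  set (u := fun s => (p s * cos (theta s) + q s * sin (theta s))%R).
  set (v := fun s => (q s * cos (theta s) - p s * sin (theta s))%R).
  pose proof (sin2_cos2 (theta 0)) as T0; pose proof (sin2_cos2 (theta s)) as T.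
  unfold Rsqr in T0, T.
  assert (Eu : u s = r).
  { transitivity (u 0%R).
    - apply is_derive_0_eq; intros t; unfold u; auto_derive.
      + repeat split; eexists; eauto.
      + rewrite (is_derive_unique (fun x : R => p x) _ _ (Hp t)),
          (is_derive_unique (fun x : R => q x) _ _ (Hq t)),
          (is_derive_unique (fun x : R => theta x) _ _ (Ht t)); ring.
    - unfold u; rewrite Hp0, Hq0.
      transitivity (r * (sin (theta 0) * sin (theta 0) + cos (theta 0) * cos (theta 0)))%R;
        [ ring | rewrite T0; ring ]. }
  assert (Ev : v s = 0%R).
  { transitivity (v 0%R).
    - apply is_derive_0_eq; intros t; unfold v; auto_derive.
      + repeat split; eexists; eauto.
      + rewrite (is_derive_unique (fun x : R => p x) _ _ (Hp t)),
          (is_derive_unique (fun x : R => q x) _ _ (Hq t)),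
          (is_derive_unique (fun x : R => theta x) _ _ (Ht t)); ring.
    - unfold v; rewrite Hp0, Hq0; ring. }
  split.
  (* Rotating back by [theta s] recovers [p] and [q] from [u = r] and [v = 0]. *)
  - transitivity (u s * cos (theta s) - v s * sin (theta s))%R;
      [ unfold u, v | rewrite Eu, Ev; ring ].
    transitivity (p s * (sin (theta s) * sin (theta s) + cos (theta s) * cos (theta s)))%R;
      [ rewrite T | ]; ring.
  - transitivity (u s * sin (theta s) + v s * cos (theta s))%R;
      [ unfold u, v | rewrite Eu, Ev; ring ].
    transitivity (q s * (sin (theta s) * sin (theta s) + cos (theta s) * cos (theta s)))%R;
      [ rewrite T | ]; ring.
Qed.

(** * Unit exponentials and the reality condition *)

Lemma Cexp_Ci (t : R) : Cexp (Ci * RtoC t) = (cos t, sin t).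
Proof.
  unfold Cexp; simpl.
  replace (0 * t - 1 * 0)%R with 0%R by ring.
  replace (0 * 0 + 1 * t)%R with t by ring.
  rewrite exp_0; apply injective_projections; simpl; ring.
Qed.

Lemma Cexp_opp_Ci (t : R) : Cexp (- (Ci * RtoC t)) = (cos t, (- sin t)%R).
Proof.
  replace (- (Ci * RtoC t)) with (Ci * RtoC (- t))
    by (apply injective_projections; simpl; ring).
  now rewrite Cexp_Ci, cos_neg, sin_neg.
Qed.

Lemma Ceq_opp_conj (x y : C) : Cconj x = - y <-> y = - Cconj x.
Proof. split; intros E; rewrite E; ring. Qed.

(** Solving for [X^-] lets it be eliminated by rewriting. The alternative form of reality reduces to
    the same formula, which gives the equivalence of the two. *)
Lemma real_field_iff (Xp Xm : Z -> C) :
  real_field Xp Xm <-> forall i, Xm i = - Cconj (Xp (i - 1)%Z).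
Proof.
  split; intros H i.
  - specialize (H (i - 1)%Z); apply Ceq_opp_conj in H.
    unfold shiftp in H; now rewrite Z.sub_add in H.
  - apply Ceq_opp_conj; unfold shiftp; now rewrite H, Z.add_simpl_r.
Qed.

Lemma real_field_alt_iff (Xp Xm : Z -> C) :
  real_field_alt Xp Xm <-> forall i, Xm i = - Cconj (Xp (i - 1)%Z).
Proof.
  split; intros H i.
  - rewrite <- (Cconj_conj (Xm i)), H; unfold shiftm.
    apply injective_projections; simpl; ring.
  - rewrite H; unfold shiftm; apply injective_projections; simpl; ring.
Qed.

(** * The geodesic equations of a real field, in terms of [X^+] alone *)

Definition sqnorm (z : C) : R := (Re z * Re z + Im z * Im z)%R.

(** For [X^+ = r exp (i theta)] this is the right-hand side of the phase equation. *)
Definition angular_speed (Xp : Z -> C) (i : Z) : R :=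
  (Im (Xp (i - 1)%Z) - Im (Xp (i + 1)%Z))%R.

(** With [a = X^+], reality gives [kappa_i = Re a_i - Re a_(i-1)]. The last term contributes
    [|a_(i-1)|^2], and the total coefficient of [a_i] collapses to [i w_i - Cconj a_i]. *)
Lemma velocityp_real (Xp Xm : Z -> C) (i : Z) :
  real_field Xp Xm ->
  partialp (kappa Xp Xm) i * Xp i - partialp Xp i * Xp i - partialm Xp i * Xm i
  = RtoC (sqnorm (Xp (i - 1)%Z) - sqnorm (Xp i))
    + Ci * RtoC (angular_speed Xp i) * Xp i.
Proof.
  rewrite real_field_iff; intros H.
  unfold kappa, partialp, partialm, shiftp, shiftm, angular_speed, sqnorm.
  rewrite !H, !Z.add_simpl_r.
  apply injective_projections; simpl; unfold Re, Im; field.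
Qed.

(** The site is [i + 1] because [X^-] there is [- Cconj a_i]; this yields a second equation for the
    same [a_i]. *)
Lemma velocitym_real (Xp Xm : Z -> C) (i : Z) :
  real_field Xp Xm ->
  partialm (kappa Xp Xm) (i + 1) * Xm (i + 1)%Z
    - partialm Xm (i + 1) * Xm (i + 1)%Z - partialp Xm (i + 1) * Xp (i + 1)%Z
  = - Cconj (RtoC (sqnorm (Xp i) - sqnorm (Xp (i + 1)%Z))
             + Ci * RtoC (angular_speed Xp i) * Xp i).
Proof.
  rewrite real_field_iff; intros H.
  unfold kappa, partialp, partialm, shiftp, shiftm, angular_speed, sqnorm.
  rewrite !H, !Z.add_simpl_r.
  apply injective_projections; simpl; unfold Re, Im; field.
Qed.

(** Constancy of the modulus in [i] is a constraint at each single time, obtained from uniqueness of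
    the derivative. Conversely it kills both real terms, and the two equations become images of each
    other under [- Cconj]. Reality is assumed at all times because it is differentiated. *)
Lemma geodesic_real_iff (Xp Xm : R -> Z -> C) (s : R) :
  (forall t, real_field (Xp t) (Xm t)) ->
  (geodesic_velocity_eqs Xp Xm s <->
   forall i,
     has_deriv (fun t => Xp t i) s (Ci * RtoC (angular_speed (Xp s) i) * Xp s i) /\
     sqnorm (Xp s i) = sqnorm (Xp s 0%Z)).
Proof.
  intros Hr.
  assert (Hm : forall t i, Xm t (i + 1)%Z = - Cconj (Xp t i)).
  { intros t i; rewrite (proj1 (real_field_iff _ _) (Hr t)).
    now rewrite Z.add_simpl_r. }
  assert (Hm' : forall t i, Xp t i = - Cconj (Xm t (i + 1)%Z)).
  { intros t i; rewrite Hm; apply injective_projections; simpl; ring. }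
  split.
  - intros [H1 H2].
    assert (Hp : forall i, has_deriv (fun t => Xp t i) s
       (RtoC (sqnorm (Xp s (i - 1)%Z) - sqnorm (Xp s i))
        + Ci * RtoC (angular_speed (Xp s) i) * Xp s i)).
    { intros i; rewrite <- (velocityp_real _ (Xm s)); auto. }
    assert (Hq : forall i, has_deriv (fun t => Xp t i) s
       (RtoC (sqnorm (Xp s i) - sqnorm (Xp s (i + 1)%Z))
        + Ci * RtoC (angular_speed (Xp s) i) * Xp s i)).
    { intros i; specialize (H2 (i + 1)%Z); rewrite velocitym_real in H2 by auto.
      apply has_deriv_opp_conj in H2.
      apply (has_deriv_ext _ (fun t => Xp t i)) in H2; [ | now intros t; rewrite Hm' ].
      match type of H2 with has_deriv _ _ ?k =>
        match goal with |- has_deriv _ _ ?l => replace l with k; trivial end end.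
      apply injective_projections; simpl; ring. }
    assert (Hn : forall i, sqnorm (Xp s i) = sqnorm (Xp s 0%Z)).
    { apply (nonneg_arith_progression_const (fun i => sqnorm (Xp s i))).
      - intros i; unfold sqnorm; nra.
      (* The two derivatives found for [a_i] coincide; their real parts give the progression
         identity. *)
      - intros i; pose proof (has_deriv_unique _ _ _ _ (Hp i) (Hq i)) as E.
        apply (f_equal Re) in E; simpl in E; lra. }
    intros i; split; trivial.
    specialize (Hp i); rewrite (Hn i), (Hn (i - 1)%Z), Rminus_diag in Hp.
    now rewrite Cplus_0_l in Hp.
  - intros H; split; intros i.
    + rewrite velocityp_real by auto.
      rewrite (proj2 (H i)), (proj2 (H (i - 1)%Z)), Rminus_diag, Cplus_0_l.
      apply H.
    + replace i with ((i - 1) + 1)%Z by ring; set (j := (i - 1)%Z).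
      rewrite velocitym_real by auto.
      rewrite (proj2 (H j)), (proj2 (H (j + 1)%Z)), Rminus_diag, Cplus_0_l.
      apply (has_deriv_ext (fun t => - Cconj (Xp t j))); [ now intros t; rewrite Hm | ].
      apply has_deriv_opp_conj, H.
Qed.

(** * From geodesics to the polar form *)

Lemma polar_of_geodesic (Xp Xm : R -> Z -> C) :
  (forall i, smoothC (fun s => Xp s i)) ->
  (forall s, real_field (Xp s) (Xm s) /\ geodesic_velocity_eqs Xp Xm s) ->
  exists r theta, polar_solution Xp Xm r theta.
Proof.
  intros hXp H.
  assert (Hr : forall s, real_field (Xp s) (Xm s)) by apply H.
  assert (Hg : forall s i,
    has_deriv (fun t => Xp t i) s (Ci * RtoC (angular_speed (Xp s) i) * Xp s i) /\
    sqnorm (Xp s i) = sqnorm (Xp s 0%Z)).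
  { intros s; apply (geodesic_real_iff _ Xm); auto; apply H. }
  (* The amplitude is read off at time 0 and site 0. The phase starts at the initial argument at
     each site and then integrates the angular speed. *)
  set (r := sqrt (sqnorm (Xp 0%R 0%Z))).
  set (w := fun i s => angular_speed (Xp s) i).
  set (theta := fun s i =>
    (angle (Re (Xp 0%R i)) (Im (Xp 0%R i)) + RInt (w i) 0 s)%R).
  assert (Hw : forall i, smooth (w i)).
  { intros i; apply smooth_minus; apply hXp. }
  assert (Ht : forall i s, is_derive (fun t => theta t i) s (w i s)).
  { intros i s; unfold theta.
    rewrite <- (Rplus_0_l (w i s)).
    apply (is_derive_plus (fun _ => angle (Re (Xp 0%R i)) (Im (Xp 0%R i))) (RInt (w i) 0)).
    - apply (is_derive_const (V := R_NormedModule)).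
    - apply (is_derive_RInt (w i) (RInt (w i) 0) 0%R).
      + apply filter_forall; intros t.
        apply (RInt_correct (V := R_CompleteNormedModule)).
        apply (ex_RInt_continuous (V := R_CompleteNormedModule)).
        intros z _; now apply smooth_continuous.
      + now apply smooth_continuous. }
  assert (Hpolar : forall i s, Re (Xp s i) = (r * cos (theta s i))%R /\
                               Im (Xp s i) = (r * sin (theta s i))%R).
  { intros i.
    assert (E0 : theta 0%R i = angle (Re (Xp 0%R i)) (Im (Xp 0%R i))).
    { unfold theta; rewrite RInt_point; apply Rplus_0_r. }
    destruct (angle_spec (Re (Xp 0%R i)) (Im (Xp 0%R i))) as [A1 A2].
    (* Constancy in [i] at time 0 turns the initial modulus at site [i] into [r]; constancy in time
       then comes from [rotation_solution]. *)
    fold (sqnorm (Xp 0%R i)) in A1, A2; rewrite (proj2 (Hg _ _)) in A1, A2.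
    apply (rotation_solution _ _ (w i)); auto.
    - intros s; destruct (proj1 (has_deriv_iff _ _ _) (proj1 (Hg s i))) as [H1 _].
      match type of H1 with is_derive _ _ ?k =>
        match goal with |- is_derive _ _ ?l => replace l with k; trivial end end.
      simpl; unfold w, Re, Im; ring.
    - intros s; destruct (proj1 (has_deriv_iff _ _ _) (proj1 (Hg s i))) as [_ H2].
      match type of H2 with is_derive _ _ ?k =>
        match goal with |- is_derive _ _ ?l => replace l with k; trivial end end.
      simpl; unfold w, Re, Im; ring.
    - now rewrite E0.
    - now rewrite E0. }
  exists r, theta; refine (conj _ (conj _ (conj _ (conj _ _)))).
  - apply sqrt_pos.
  - intros i; now apply (smooth_primitive _ (w i)).
  - intros s i; rewrite Cexp_Ci; destruct (Hpolar i s) as [A B].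
    apply injective_projections; simpl; unfold Re, Im in A, B; rewrite ?A, ?B; ring.
  - intros s i; unfold shiftm; rewrite Cexp_opp_Ci.
    rewrite (proj1 (real_field_iff _ _) (Hr s)).
    destruct (Hpolar (i - 1)%Z s) as [A B].
    apply injective_projections; simpl; unfold Re, Im in A, B; rewrite ?A, ?B; ring.
  - intros s i; unfold shiftm, shiftp.
    replace (r * (sin (theta s (i - 1)%Z) - sin (theta s (i + 1)%Z)))%R with (w i s);
      trivial.
    unfold w, angular_speed.
    rewrite (proj2 (Hpolar (i - 1)%Z s)), (proj2 (Hpolar (i + 1)%Z s)); ring.
Qed.

(** * From the polar form back to geodesics, and its consequences *)

Lemma polar_real_field (Xp Xm : R -> Z -> C) (r : R) (theta : R -> Z -> R) :
  polar_solution Xp Xm r theta -> forall s, real_field (Xp s) (Xm s).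
Proof.
  intros (_ & _ & Hp & Hm & _) s; apply real_field_iff; intros i.
  rewrite Hp, Hm; unfold shiftm; rewrite Cexp_Ci, Cexp_opp_Ci.
  apply injective_projections; simpl; ring.
Qed.

Lemma has_deriv_polar (theta : R -> R) (r s w : R) :
  is_derive theta s w ->
  has_deriv (fun t => ((r * cos (theta t))%R, (r * sin (theta t))%R)) s
    (Ci * RtoC w * ((r * cos (theta s))%R, (r * sin (theta s))%R)).
Proof.
  intros H; apply has_deriv_iff; unfold Re, Im; simpl; split; auto_derive;
    try (repeat split; eexists; eauto; fail);
    rewrite (is_derive_unique (fun x : R => theta x) _ _ H); ring.
Qed.

Lemma geodesic_of_polar (Xp Xm : R -> Z -> C) (r : R) (theta : R -> Z -> R) :
  polar_solution Xp Xm r theta -> forall s, geodesic_velocity_eqs Xp Xm s.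
Proof.
  intros H s; apply geodesic_real_iff; [ now apply (polar_real_field _ _ r theta) | ].
  destruct H as (_ & _ & Hp & _ & Ht).
  assert (Hp' : forall t i, Xp t i = ((r * cos (theta t i))%R, (r * sin (theta t i))%R)).
  { intros t i; rewrite Hp, Cexp_Ci; apply injective_projections; simpl; ring. }
  intros i; split.
  - specialize (Ht s i); unfold shiftp, shiftm in Ht.
    apply (has_deriv_ext (fun t => ((r * cos (theta t i))%R, (r * sin (theta t i))%R)));
      [ now intros t; rewrite Hp' | ].
    rewrite Hp'; apply has_deriv_polar.
    unfold angular_speed; rewrite !Hp'; simpl.
    now rewrite <- Rmult_minus_distr_l.
  - rewrite !Hp'; unfold sqnorm; simpl.
    pose proof (sin2_cos2 (theta s i)) as T; pose proof (sin2_cos2 (theta s 0%Z)) as T0.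
    unfold Rsqr in T, T0.
    transitivity (r * r * (sin (theta s i) * sin (theta s i)
                           + cos (theta s i) * cos (theta s i)))%R; [ ring | ].
    (* Both squared moduli are [r^2]: the 1 from site [i] is expanded again as the sum of squares at
       site 0. *)
    rewrite T, <- T0; ring.
Qed.

(** The differences of [X^+] and [X^-] are conjugate to each other, so imaginary parts cancel and
    only differences of [r cos theta] remain. *)
Lemma kappa_polar (Xp Xm : R -> Z -> C) (r : R) (theta : R -> Z -> R) :
  polar_solution Xp Xm r theta ->
  forall s i, kappa (Xp s) (Xm s) i
              = - RtoC r * partialm (fun j => RtoC (cos (theta s j))) i.
Proof.
  intros (_ & _ & Hp & Hm & _) s i.
  unfold kappa, partialp, partialm, shiftp, shiftm.
  rewrite !Hp, !Hm; unfold shiftm; rewrite !Z.add_simpl_r, !Cexp_Ci, !Cexp_opp_Ci.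
  apply injective_projections; simpl; unfold Re, Im; field.
Qed.

Theorem mainTheorem1 (Xp Xm : R -> Z -> C)
    (hXp : forall i : Z, smoothC (fun s => Xp s i))
    (hXm : forall i : Z, smoothC (fun s => Xm s i)) :
  (forall s : R, real_field (Xp s) (Xm s) <-> real_field_alt (Xp s) (Xm s)) /\
  ((forall s : R, real_field (Xp s) (Xm s) /\ geodesic_velocity_eqs Xp Xm s)
   <->
   (exists (r : R) (theta : R -> Z -> R), polar_solution Xp Xm r theta)) /\
  (forall (r : R) (theta : R -> Z -> R), polar_solution Xp Xm r theta ->
     (forall (s : R) (i : Z),
        kappa (Xp s) (Xm s) i
        = - RtoC r * partialm (fun j => RtoC (cos (theta s j))) i) /\
     (forall (psi : R -> Z -> C) (s : R),
        amplitude_flow_eq Xp Xm psi s <->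
        (forall i : Z, has_deriv (fun t => psi t i) s
           (- RtoC r * partialp (psi s) i * Cexp (Ci * RtoC (theta s i))
            + RtoC r * partialm (psi s) i
              * shiftm (fun j => Cexp (- (Ci * RtoC (theta s j)))) i
            - psi s i * kappa (Xp s) (Xm s) i)))).
Proof.
  split; [ | split ].
  - intros s; now rewrite real_field_iff, real_field_alt_iff.
  - split.
    + now apply polar_of_geodesic.
    + intros (r & theta & H) s; split.
      * now apply (polar_real_field _ _ r theta).
      * now apply (geodesic_of_polar _ _ r theta).
  - intros r theta H; split; [ now apply kappa_polar | ].
    destruct H as (_ & _ & Hp & Hm & _).
    intros psi s; unfold amplitude_flow_eq.
    assert (E : forall i,
      - partialp (psi s) i * Xp s i - partialm (psi s) i * Xm s i
        - psi s i * kappa (Xp s) (Xm s) i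
      = - RtoC r * partialp (psi s) i * Cexp (Ci * RtoC (theta s i))
        + RtoC r * partialm (psi s) i
          * shiftm (fun j => Cexp (- (Ci * RtoC (theta s j)))) i
        - psi s i * kappa (Xp s) (Xm s) i).
    { intros i; rewrite Hp, Hm; unfold shiftm; ring. }
    split; intros D i; specialize (D i); [ rewrite <- E | rewrite E ]; exact D.
Qed.
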